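(* Let $m\ge1$ and $j\ge0$ be integers and let $\alpha,\beta$ be real numbers with $\alpha+1-m-\beta\notin\{0,1,\dots,m-1\}$ satisfying either (A) $\beta\in(-1,0)$ and $\alpha+1-m\in(-1,0)$, or (B) $\beta\in(0,\infty)$ and $\alpha+1-m\in(0,\infty)$. Then the exceptional Jacobi polynomial $\hat P^{(\alpha,\beta)}_{m,m+j}$ has exactly $j$ regular zeros and, counted with multiplicity, $m$ exceptional zeros.
   Context: For real $a,b$ and integer $n\ge0$, $P^{(a,b)}_n(z)=\sum_{s=0}^{n}\binom{n+a}{n-s}\binom{n+b}{s}\left(\frac{z-1}{2}\right)^s\left(\frac{z+1}{2}\right)^{n-s}$ is the Jacobi polynomial (generalized binomial coefficients), and $P^{(a,b)}_{-1}:=0$. For integers $m,j\ge0$ the exceptional ($X_m$-)Jacobi polynomial is $$\hat P^{(\alpha,\beta)}_{m,m+j}=\frac{(-1)^m}{\alpha+1+j}\left(\tfrac12(1+\alpha+\beta+j)(z-1)P^{(-\alpha-1,\beta-1)}_mP^{(\alpha+2,\beta)}_{j-1}+(\alpha+1-m)P^{(-\alpha-2,\beta)}_mP^{(\alpha+1,\beta-1)}_j\right).$$ Its zeros in $(-1,1)$ are called regular; all other zeros, whether in $(-\infty,-1)\cup(1,\infty)$ or complex (non-real), are called exceptional. *)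

(* Defs.v *)
From HB Require Import structures.
From mathcomp Require Import all_boot all_order all_algebra.
From mathcomp Require Import all_classical all_reals.
From mathcomp Require Import complex.

Set Implicit Arguments.
Unset Strict Implicit.
Unset Printing Implicit Defensive.

Import Order.TTheory GRing.Theory Num.Theory.

Local Open Scope classical_set_scope.
Local Open Scope ring_scope.

(* Generalized binomial coefficient x (x - 1) ... (x - k + 1) / k!. *)
Definition gbinom (R : realType) (x : R) (k : nat) : R :=
  (\prod_(i < k) (x - i%:R)) / (k`!)%:R.

(* The degree index is an integer so that the convention P_{-1} = 0 applies
   literally to the index j - 1 when j = 0. *)
Definition jacobi (R : realType) (a b : R) (n : int) : {poly R} :=
  match n with
  | Posz n =>
      \sum_(s < n.+1)
        (gbinom (n%:R + a) (n - s) * gbinom (n%:R + b) s) *: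
        ((2^-1 *: ('X - 1)) ^+ s * (2^-1 *: ('X + 1)) ^+ (n - s))
  | Negz _ => 0
  end.

(* xjacobi alpha beta m j is the exceptional X_m-Jacobi polynomial whose degree
   index is m + j. *)
Definition xjacobi (R : realType) (alpha beta : R) (m j : nat) : {poly R} :=
  ((-1) ^+ m / (alpha + 1 + j%:R)) *:
    ((2^-1 * (1 + alpha + beta + j%:R)) *:
       (('X - 1) * jacobi (- alpha - 1) (beta - 1) m%:Z
                 * jacobi (alpha + 2) beta (j%:Z - 1))
     + (alpha + 1 - m%:R) *:
       (jacobi (- alpha - 2) beta m%:Z
        * jacobi (alpha + 1) (beta - 1) j%:Z)).

Definition complex_poly (R : realType) (p : {poly R}) : {poly R[i]} :=
  map_poly (real_complex R) p.

Definition regular_zeros (R : realType) (p : {poly R}) : set R :=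
  [set x : R | -1 < x < 1 /\ root p x].

(* The points 1 and -1 are in neither class: a zero there would not be counted
   at all. *)
Definition exceptional_zeros (R : realType) (p : {poly R}) : set R[i] :=
  [set z : R[i] | root (complex_poly p) z /\
     (complex.Im z != 0 \/
      (complex.Im z = 0 /\ (complex.Re z < -1 \/ 1 < complex.Re z)))].

(* Main.v *)
(** Write [u = P_m^(-alpha-1, beta-1)] and [y = P_j^(alpha+1, beta-1)].  Up to a
nonzero constant the exceptional polynomial is the Darboux transform
[W = (z - 1) (u y' - u' y) + (alpha + 1) u y], and the two Jacobi equations give
the adjoint relation [(1 + z) W' + beta W = C u y] with
[C = (m + j + beta) (j + alpha + 1 - m)], nonzero under the hypotheses.  All
terms of the sum defining [u] have the same sign on [-1, 1], so [u] has no zero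
there.

At a zero of [y] the sign of [W] is that of [- u y'], and at a zero of [W] the
sign of [W'] is that of [C u y].  Hence a zero of either polynomial lies strictly
between any two zeros of the other in (-1, 1), and the signs at -1 and 1 decide
whether there are further zeros next to the endpoints.  As [y] has [j] zeros in
(-1, 1) when [beta > 0], and [j - 1] of them when [beta < 0 < j], this gives
exactly [j] zeros of [W]; they are simple, [W] does not vanish at -1 and 1, and
[W] has degree [m + j], which leaves [m] exceptional zeros.  The zeros of
Jacobi polynomials are located by the same alternation argument, applied to the
Rodrigues relation between [P_(n+1)^(a, b)] and [P_n^(a+1, b+1)]. *)

Require Import Defs.
From HB Require Import structures.
From mathcomp Require Import all_boot all_order all_algebra.
From mathcomp Require Import all_classical all_reals.
From mathcomp Require Import finmap complex.
From mathcomp Require Import polyrcf ring lra.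

Set Implicit Arguments.
Unset Strict Implicit.
Unset Printing Implicit Defensive.

Import Order.TTheory GRing.Theory Num.Theory.

Local Open Scope classical_set_scope.
Local Open Scope card_scope.
Local Open Scope ring_scope.

#[local] Arguments jacobi : simpl never.

(** * Contiguity relations of Jacobi polynomials *)

Lemma deriv_sum (R : nzRingType) (I : Type) (s : seq I) (F : I -> {poly R}) :
  (\sum_(i <- s) F i)^`() = \sum_(i <- s) (F i)^`().
Proof. exact: raddf_sum. Qed.

Lemma gbinom0 (R : realType) (x : R) : gbinom x 0 = 1.
Proof. by rewrite /gbinom big_ord0 fact0 divr1. Qed.

Lemma gbinomS (R : realType) (x : R) k :
  k.+1%:R * gbinom x k.+1 = (x - k%:R) * gbinom x k.
Proof.
rewrite /gbinom big_ord_recr /= factS natrM.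
have h1 : k.+1%:R != 0 :> R by rewrite pnatr_eq0.
have h2 : (k`!)%:R != 0 :> R by rewrite pnatr_eq0 -lt0n fact_gt0.
by field; rewrite h2 addrC natr1 h1.
Qed.

Lemma gbinomSS (R : realType) (x : R) k :
  k.+1%:R * gbinom (x + 1) k.+1 = (x + 1) * gbinom x k.
Proof.
rewrite /gbinom big_ord_recl /= factS natrM subr0.
under eq_bigr => i _ do rewrite /bump /= add1n -natr1 opprD addrACA subrr addr0.
have h1 : k.+1%:R != 0 :> R by rewrite pnatr_eq0.
have h2 : (k`!)%:R != 0 :> R by rewrite pnatr_eq0 -lt0n fact_gt0.
by field; rewrite h2 addrC natr1 h1.
Qed.

Definition jacobi_coef (R : realType) (a b : R) (n s : nat) : R :=
  gbinom (n%:R + a) (n - s) * gbinom (n%:R + b) s.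

Definition jacobi_mono (R : realType) (n s : nat) : {poly R} :=
  (2^-1 *: ('X - 1)) ^+ s * (2^-1 *: ('X + 1)) ^+ (n - s).

Lemma jacobiE (R : realType) (a b : R) (n : nat) :
  jacobi a b n =
  \sum_(s < n.+1) jacobi_coef a b n s *: jacobi_mono R n s.
Proof. by []. Qed.

Lemma jacobi0 (R : realType) (a b : R) : jacobi a b 0%N = 1.
Proof.
rewrite jacobiE big_ord1 /jacobi_coef /jacobi_mono !gbinom0.
by rewrite !expr0 !mulr1 scale1r.
Qed.

(** As [n + 1 + a = n + (a + 1)], the upper entries of the binomials agree on both sides and only
    one lower index moves. Together with [jacobi_coefr] this yields the derivative and Rodrigues
    formulas term by term. *)
Lemma jacobi_coefl (R : realType) (a b : R) (n s : nat) : (s <= n)%N ->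
  (n.+1 - s)%:R * jacobi_coef a b n.+1 s =
  (s%:R + a + 1) * jacobi_coef (a + 1) (b + 1) n s.
Proof.
move=> sn; rewrite /jacobi_coef subSn // mulrA gbinomS.
have -> : n.+1%:R + a = n%:R + (a + 1) by ring.
have -> : n.+1%:R + b = n%:R + (b + 1) by ring.
by rewrite mulrA natrB //; ring.
Qed.

Lemma jacobi_coefr (R : realType) (a b : R) (n s : nat) : (s <= n)%N ->
  s.+1%:R * jacobi_coef a b n.+1 s.+1 =
  ((n - s)%:R + b + 1) * jacobi_coef (a + 1) (b + 1) n s.
Proof.
move=> sn; rewrite /jacobi_coef subSS mulrCA gbinomS.
have -> : n.+1%:R + a = n%:R + (a + 1) by ring.
have -> : n.+1%:R + b = n%:R + (b + 1) by ring.
by rewrite natrB //; ring.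
Qed.

Lemma deriv_jacobi_mono (R : realType) (n s : nat) :
  (jacobi_mono R n s)^`() =
  2^-1 *: (s%:R *: ((2^-1 *: ('X - 1)) ^+ s.-1 *
                    (2^-1 *: ('X + 1)) ^+ (n - s))
           + (n - s)%:R *: ((2^-1 *: ('X - 1)) ^+ s *
                            (2^-1 *: ('X + 1)) ^+ (n - s).-1)).
Proof.
rewrite /jacobi_mono derivM !deriv_exp !derivZ !derivB !derivD !derivX derivC.
rewrite subr0 addr0 !alg_polyC.
set X : {poly R} := _ *: ('X - 1); set Y : {poly R} := _ *: ('X + 1).
move: (2^-1 : R) => h.
move: (n - s)%N (X ^+ s) (X ^+ s.-1) (Y ^+ _) (Y ^+ _) => k X0 X1 Y0 Y1.
rewrite !scaler_nat -mul_polyC.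
by ring.
Qed.

(** Each term contributes to two neighbouring monomials of degree [n]. After an index shift their
    factors [n - s + b + 1] and [s + a + 1] add up to [n + a + b + 2], which is independent of
    [s]. *)
Lemma deriv_jacobi (R : realType) (a b : R) (n : nat) :
  (jacobi a b n.+1)^`() =
  ((n.+1%:R + a + b + 1) / 2) *: jacobi (a + 1) (b + 1) n.
Proof.
rewrite !jacobiE deriv_sum.
under eq_bigr => s _ do
  rewrite derivZ deriv_jacobi_mono scalerA mulrC -scalerA scalerDr.
rewrite -scaler_sumr big_split /= big_ord_recl /= scale0r scaler0 add0r.
rewrite [X in _ + X]big_ord_recr /= subnn scale0r scaler0 addr0 -big_split /=.
rewrite mulrC -scalerA; congr (_ *: _); rewrite scaler_sumr.
apply: eq_bigr => s _.
have sn : (s <= n)%N by rewrite -ltnS.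
rewrite /bump /= add1n subSS subSn //= !scalerA -scalerDl.
rewrite mulrC jacobi_coefr // mulrC [_ * (_.+1)%:R]mulrC -subSn // jacobi_coefl //.
by rewrite natrB // /jacobi_mono; congr (_ *: _); ring.
Qed.

(* With [X = (z - 1) / 2] and [Y = (z + 1) / 2] one has [1 - z^2 = - 4 X Y], so
   the relation is homogeneous in [X] and [Y]. *)
Lemma jacobi_mono_rodrigues (R : realType) (a b : R) (n s : nat) :
  (s <= n)%N ->
  (1 - 'X^2) * (jacobi_mono R n s)^`() +
  (b *: (1 - 'X) - a *: (1 + 'X)) * jacobi_mono R n s =
  (- 2) *: ((s%:R + a) *: jacobi_mono R n.+1 s
            + ((n - s)%:R + b) *: jacobi_mono R n.+1 s.+1).
Proof.
move=> sn; rewrite deriv_jacobi_mono /jacobi_mono subSS subSn //.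
have X1 : ('X - 1 : {poly R}) = 2 *: (2^-1 *: ('X - 1)).
  by rewrite scalerA divff ?scale1r // pnatr_eq0.
have X2 : ('X + 1 : {poly R}) = 2 *: (2^-1 *: ('X + 1)).
  by rewrite scalerA divff ?scale1r // pnatr_eq0.
have -> : 1 - 'X^2 = - (('X - 1) * ('X + 1)) :> {poly R} by ring.
have -> : 1 - 'X = - ('X - 1) :> {poly R} by ring.
have -> : 1 + 'X = 'X + 1 :> {poly R} by ring.
have h2 : 2 * (2^-1 : R) = 1 by rewrite divff // pnatr_eq0.
set X : {poly R} := 2^-1 *: ('X - 1) in X1 *.
set Y : {poly R} := 2^-1 *: ('X + 1) in X2 *.
have {h2} : 2 * (2^-1 : R)%:P = 1 by rewrite -polyC_natr -polyCM h2.
rewrite -[2^-1 *: _]mul_polyC {}X1 {}X2.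
move: X Y (2^-1 : R)%:P (n - s)%N => X Y h k h2.
(* At [s = 0] the exponent [s.-1] is truncated to [0], but the factor [s%:R] vanishes as well. *)
have hX : X * (s%:R *: X ^+ s.-1) = s%:R *: X ^+ s.
  by case: (s) => [|i] /=; rewrite ?scale0r ?mulr0 // exprS -scalerAr.
have hY : Y * (k%:R *: Y ^+ k.-1) = k%:R *: Y ^+ k.
  by case: (k) => [|i] /=; rewrite ?scale0r ?mulr0 // exprS -scalerAr.
rewrite !exprS.
transitivity (- (2 * h) * 2 * (Y * (Y ^+ k) * (X * (s%:R *: X ^+ s.-1))
   + X * (X ^+ s) * (Y * (k%:R *: Y ^+ k.-1)))
   + (b *: - (2 *: X) - a *: (2 *: Y)) * (X ^+ s * Y ^+ k)).
  move: (X ^+ s.-1) (Y ^+ k.-1) (X ^+ s) (Y ^+ k) => X1 Y1 X2 Y2.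
  congr (_ + _); rewrite !scaler_nat; ring.
rewrite hX hY h2; move: (X ^+ s) (Y ^+ k) => X2 Y2.
rewrite -!mul_polyC !polyCD !polyCN !polyC_natr.
move: b%:P a%:P => b' a'. ring.
Qed.

(** The right side is the derivative of [(1 - z)^(a+1) (1 + z)^(b+1) Q] divided by
    [(1 - z)^a (1 + z)^b]. *)
Lemma jacobi_rodrigues (R : realType) (a b : R) (n : nat) :
  let Q := jacobi (a + 1) (b + 1) n in
  (- (2 * n.+1%:R)) *: jacobi a b n.+1 =
  (1 - 'X^2) * Q^`() +
  ((b + 1) *: (1 - 'X) - (a + 1) *: (1 + 'X)) * Q.
Proof.
move=> Q; rewrite {}/Q !jacobiE deriv_sum !mulr_sumr -big_split /=.
under [RHS]eq_bigr => s _.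
  rewrite derivZ -!scalerAr -scalerDr jacobi_mono_rodrigues -1?ltnS //.
  rewrite scalerA mulrC -scalerA scalerDr !scalerA.
  over.
rewrite -scaler_sumr -mulNr -scalerA; congr (_ *: _).
rewrite big_split /= scaler_sumr.
under [LHS]eq_bigr => s _.
  have sn : (s <= n.+1)%N by rewrite -ltnS.
  have -> : n.+1%:R = (n.+1 - s)%:R + s%:R :> R by rewrite -natrD subnK.
  rewrite scalerA mulrDl scalerDl.
  over.
rewrite big_split /= big_ord_recr /= subnn mul0r scale0r addr0.
rewrite [X in _ + X]big_ord_recl /= mul0r scale0r add0r.
congr (_ + _); apply: eq_bigr => s _; congr (_ *: _);
  have sn : (s <= n)%N by rewrite -ltnS.
  by rewrite jacobi_coefl // addrA mulrC.
by rewrite /bump /= add1n jacobi_coefr // addrA mulrC.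
Qed.

Lemma jacobi_mono_lower (R : realType) (a : R) (n s : nat) : (s <= n)%N ->
  a *: jacobi_mono R n s + ('X - 1) * (jacobi_mono R n s)^`() =
  (s%:R + a) *: jacobi_mono R n s + (n - s)%:R *: jacobi_mono R n s.+1.
Proof.
move=> sn; rewrite deriv_jacobi_mono /jacobi_mono.
have X1 : ('X - 1 : {poly R}) = 2 *: (2^-1 *: ('X - 1)).
  by rewrite scalerA divff ?scale1r // pnatr_eq0.
have h2 : 2 * (2^-1 : R) = 1 by rewrite divff // pnatr_eq0.
set X : {poly R} := 2^-1 *: ('X - 1) in X1 *.
set Y : {poly R} := 2^-1 *: ('X + 1).
have {h2} : 2 * (2^-1 : R)%:P = 1 by rewrite -polyC_natr -polyCM h2.
rewrite -[2^-1 *: _]mul_polyC {}X1 subnS.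
move: X Y (2^-1 : R)%:P (n - s)%N => X Y h k h2.
have hX : X * (s%:R *: X ^+ s.-1) = s%:R *: X ^+ s.
  by case: (s) => [|i] /=; rewrite ?scale0r ?mulr0 // exprS -scalerAr.
rewrite !exprS.
transitivity (a *: (X ^+ s * Y ^+ k) + 2 * h * ((X * (s%:R *: X ^+ s.-1)) * Y ^+ k
   + k%:R *: (X * X ^+ s * Y ^+ k.-1))).
  move: (X ^+ s.-1) (Y ^+ k.-1) (X ^+ s) (Y ^+ k) => X1 Y1 X2 Y2.
  congr (_ + _); rewrite !scaler_nat; ring.
rewrite hX h2; move: (Y ^+ k.-1) (X ^+ s) (Y ^+ k) => Y1 X2 Y2.
rewrite -!mul_polyC !polyCD !polyC_natr; move: a%:P => a'; ring.
Qed.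

Lemma gbinomD1 (R : realType) (x : R) k :
  gbinom (x + 1) k.+1 = gbinom x k.+1 + gbinom x k.
Proof.
have h1 : k.+1%:R != 0 :> R by rewrite pnatr_eq0.
apply: (mulfI h1); rewrite gbinomSS mulrDr gbinomS; ring.
Qed.

Lemma gbinom_absorb (R : realType) (x : R) k :
  (x + 1) * gbinom x k = (x + 1 - k%:R) * gbinom (x + 1) k.
Proof. by rewrite -gbinomSS gbinomS. Qed.

(** Serves to express the factor [P_m^(-alpha-2, beta)] of the exceptional polynomial through [u]
    and [u']. Termwise it is Pascal's rule for the second binomial and absorption for the first. *)
Lemma jacobi_lower (R : realType) (a b : R) (n : nat) :
  a *: jacobi a b n + ('X - 1) * (jacobi a b n)^`() =
  (n%:R + a) *: jacobi (a - 1) (b + 1) n.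
Proof.
rewrite !jacobiE deriv_sum mulr_sumr scaler_sumr -big_split /=.
under eq_bigr => s _.
  rewrite derivZ -scalerAr scalerA mulrC -scalerA -scalerDr.
  rewrite jacobi_mono_lower -1?ltnS // scalerDr !scalerA.
  over.
rewrite big_split /= scaler_sumr [X in _ + X]big_ord_recr /=.
rewrite subnn mulr0 scale0r addr0 [RHS]big_ord_recl big_ord_recl /=.
rewrite -addrA -big_split /=.
have na : n%:R + a = (n%:R + (a - 1)) + 1 by ring.
have nb : n%:R + (b + 1) = (n%:R + b) + 1 by ring.
congr (_ + _).
  rewrite scalerA; congr (_ *: _).
  rewrite /jacobi_coef !gbinom0 !mulr1 na gbinom_absorb -na subn0.
  by rewrite mulrC; congr (_ * _); ring.
apply: eq_bigr => s _; rewrite /bump /= add1n -scalerDl scalerA.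
congr (_ *: _).
have sn := ltn_ord s.
have E0 := gbinom_absorb (n%:R + (a - 1)) (n - s.+1); rewrite -na in E0.
have E1 := gbinomS (n%:R + a) (n - s.+1).
rewrite -subSn // subSS in E1.
rewrite /jacobi_coef nb gbinomD1 mulrA E0 [RHS]mulrDr; congr (_ + _).
  by rewrite natrB // -natr1; ring.
by rewrite -E1; ring.
Qed.

(** * Interlacing of zeros *)

(** Write [p = g (X - a) (X - b)]. The cofactor [g] keeps its sign on [[a, b]], so
    [p'(a) = (a - b) g(a)] and [p'(b) = (b - a) g(b)] have opposite signs. Then so do [q(a)] and
    [q(b)]. *)
Lemma root_between_consecutive (R : rcfType) (p q : {poly R}) (s a b : R) :
  a < b -> root p a -> root p b ->
  {in `]a, b[, forall x, ~~ root p x} ->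
  0 < s * q.[a] * p^`().[a] -> 0 < s * q.[b] * p^`().[b] ->
  exists2 x, x \in `]a, b[ & root q x.
Proof.
move=> ab /factor_theorem [g1 ->]; rewrite rootM root_XsubC.
rewrite (gt_eqF ab) orbF => /factor_theorem [g ->] noroot.
rewrite !derivM !derivXsubC !mulr1 !(hornerXsubC, hornerD, hornerM).
rewrite !subrr !mulr0 !addr0 => sa sb.
have noroot_g : {in `]a, b[, forall x, ~~ root g x}.
  by move=> x xab; move: (noroot x xab); rewrite !rootM !negb_or => /andP[/andP[]].
have gab : 0 < g.[a] * g.[b].
  rewrite ltNge le_eqVlt; apply/negP => /orP[|gab].
    rewrite mulf_eq0 => /orP[]/eqP g0; move: sa sb;
      by rewrite g0 !(mul0r, mulr0, add0r) ltxx.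
  have [x xab gx] := poly_ivtoo (ltW ab) gab.
  by move/negP: (noroot_g x xab).
have qab : q.[a] * q.[b] < 0.
  rewrite ltNge; apply/negP => qab.
  have := mulr_gt0 sa sb; rewrite ltNge => /negP; apply.
  have : 0 <= (s * (b - a)) ^+ 2 * (g.[a] * g.[b]) * (q.[a] * q.[b]).
    by rewrite mulr_ge0 // mulr_ge0 ?sqr_ge0 // ltW.
  by rewrite -oppr_le0; congr (_ <= _); ring.
by have [x xab qx] := poly_ivtoo (ltW ab) qab; exists x.
Qed.

Lemma root_between (R : rcfType) (p q : {poly R}) (s a b : R) :
  a < b -> root p a -> root p b ->
  {in `[a, b], forall x, root p x -> 0 < s * q.[x] * p^`().[x]} ->
  exists2 x, a < x < b & root q x.
Proof.
move=> ab pa pb sgn.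
have p0 : p != 0.
  apply: contraTneq (sgn a _ pa); last by rewrite in_itv /= lexx ltW.
  by move=> ->; rewrite deriv0 horner0 mulr0 ltxx.
have [c [ac cb pc noroot]] : exists c, [/\ a < c, c <= b, root p c &
    {in `]a, c[, forall x, ~~ root p x}].
  case: (next_rootP p a b) => [/eqP|c _ /rootP pc|c _ cE noroot].
  - by rewrite (negPf p0).
  - by rewrite in_itv /= => /andP[ac /ltW cb]; exists c.
  - by exists b; split.
have [||x] := root_between_consecutive ac pa pc noroot (sgn a _ pa).
- by rewrite in_itv /= lexx ltW.
- by apply: sgn => //; rewrite in_itv /= (ltW ac) cb.
rewrite in_itv /= => /andP[ax xc] qx; exists x => //.
by rewrite ax (lt_le_trans xc).
Qed.

(** Only a lower bound on the number of distinct zeros; upper bounds are stated by bounding every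
    admissible [n]. *)
Definition has_zeros (R : rcfType) (a b : R) (p : {poly R}) (n : nat) : Prop :=
  exists2 xs : seq R, uniq xs /\ size xs = n &
    {in xs, forall x, a < x < b /\ root p x}.

Lemma has_zeros0 (R : rcfType) (a b : R) (p : {poly R}) : has_zeros a b p 0.
Proof. by exists [::]. Qed.

Lemma has_zeros_size (R : rcfType) (a b : R) (p : {poly R}) (n : nat) :
  p != 0 -> has_zeros a b p n -> (n < size p)%N.
Proof.
move=> p0 [xs [uxs <-] rxs]; apply: max_poly_roots => //.
by apply/allP => x /rxs[].
Qed.

Lemma has_zeros_path (R : rcfType) (p q : {poly R}) (x : R) (xs : seq R) :
  (forall y z, x <= y -> y < z -> z <= last x xs -> root p y -> root p z ->
     exists2 t, y < t < z & root q t) ->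
  path <%R x xs -> all (root p) (x :: xs) ->
  has_zeros x (last x xs) q (size xs).
Proof.
elim: xs x => [|y xs IH] x /= between; first by move=> _ _; apply: has_zeros0.
move=> /andP[xy pxs] /and3P[px py rxs].
have ylast : y <= last y xs.
  move: pxs; rewrite lt_path_sortedE => /andP[/allP ally _].
  by have := mem_last y xs; rewrite inE => /orP[/eqP->|/ally/ltW].
have [t /andP[xt ty] qt] := between x y (lexx x) xy ylast px py.
have [||ts [uts sts] qts] := IH y _ pxs; last 1 first.
- exists (t :: ts).
    rewrite /= uts sts andbT; split=> //; apply/negP => /qts[/andP[yt _] _].
    by move: (lt_trans ty yt); rewrite ltxx.
  move=> z; rewrite inE => /orP[/eqP->|/qts[/andP[yz zl] qz]].
    by rewrite xt (lt_le_trans ty ylast).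
  by rewrite (lt_trans xy yz) zl.
- move=> u v yu; exact: (between u v (le_trans (ltW xy) yu)).
- by rewrite /= py.
Qed.

(* Multiplying [p] by [X - a] when [l] holds and by [b - X] when [r] holds makes
   the endpoints zeros of the product, with the sign of its derivative there
   given by the endpoint hypotheses. *)
Lemma has_zeros_interlace (R : rcfType) (p q : {poly R}) (s a b : R)
    (l r : bool) (n : nat) :
  a < b ->
  (forall x, a < x < b -> root p x -> 0 < s * q.[x] * p^`().[x]) ->
  (l -> 0 < s * q.[a] * p.[a]) -> (r -> s * q.[b] * p.[b] < 0) ->
  has_zeros a b p n -> has_zeros a b q (n + l + r).-1.
Proof.
move=> ab sgn sgna sgnb [xs [uxs sxs] rxs].
(* Known zeros of [pp], endpoints included: [n + l + r] points have one gap fewer, whence the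
   predecessor in the conclusion. *)
pose big := nseq l a ++ xs ++ nseq r b.
pose pp := p * ('X - a%:P) ^+ l * (b%:P - 'X) ^+ r.
have in_big t : t \in big -> [\/ t = a /\ l, t = b /\ r | a < t < b /\ root p t].
  rewrite !mem_cat !mem_nseq !lt0b => /or3P[/andP[lT /eqP]|/rxs|/andP[rT /eqP]].
  - by constructor 1.
  - by constructor 3.
  - by constructor 2.
have axs : a \notin xs by apply/negP => /rxs[]; rewrite ltxx.
have bxs : b \notin xs by apply/negP => /rxs[]; rewrite ltxx andbF.
have ubig : uniq big.
  rewrite /big; case: (l) (r) => [] [] /=;
    rewrite ?cats0 ?cats1 ?rcons_uniq ?uxs ?axs ?bxs //=.
  by rewrite mem_rcons inE negb_or (lt_eqF ab) axs.
have sbig : size (sort <=%R big) = (n + l + r)%N.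
  by rewrite size_sort !size_cat !size_nseq sxs addnA (addnC l).
have ltbig : sorted <%R (sort <=%R big) by rewrite sort_lt_sorted.
have bigE t : (t \in sort <=%R big) = (t \in big) by rewrite mem_sort.
case: (sort <=%R big) sbig ltbig bigE => [<- _ _|y ys /= <- pys bigE].
  exact: has_zeros0.
have rpp : all (root pp) (y :: ys).
  apply/allP => t; rewrite bigE => /in_big[[-> lT]|[-> rT]|[_ rt]]; rewrite !rootM.
  - by rewrite lT expr1 root_XsubC eqxx orbT.
  - rewrite rT expr1 (rootE (b%:P - 'X)) hornerD hornerN hornerC hornerX.
    by rewrite subrr eqxx orbT.
  - by rewrite rt.
have ay : a <= y.
  by have := mem_head y ys; rewrite bigE => /in_big[[->]|[->]|[/andP[/ltW]]] //; rewrite ltW.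
have lb : last y ys <= b.
  have := mem_last y ys; rewrite bigE => /in_big[[->]|[->]|[/andP[_ /ltW]]] //.
  by rewrite ltW.
have [|ts [uts sts] qts] := @has_zeros_path _ pp q y ys _ pys rpp; last first.
  exists ts => // t /qts[/andP[yt tl] qt].
  by rewrite (le_lt_trans ay yt) (lt_le_trans tl lb).
move=> u v yu uv vl pu pv.
have [|t] := @root_between _ pp q s u v uv pu pv; last by exists t.
move=> t; rewrite in_itv /= => /andP[ut tv].
have at_ : a <= t by rewrite (le_trans ay) // (le_trans yu).
have tb : t <= b by rewrite (le_trans tv) // (le_trans vl).
(* At [a], if [l] holds, only [p(a) (b - a)^r] survives; at [b], if [r] holds, only
   [- p(b) (b - a)^l]. Hence the opposite signs in the two endpoint hypotheses. *)
have dpp : pp^`().[t] = p^`().[t] * (t - a) ^+ l * (b - t) ^+ r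
    + p.[t] * (l%:R * (b - t) ^+ r - r%:R * (t - a) ^+ l).
  rewrite /pp; case: (l) (r) => [] [] /=; rewrite ?expr1 ?expr0 ?mulr1;
    rewrite ?(derivM, derivB, derivX, derivC,
              hornerM, hornerD, hornerN, hornerC, hornerX);
    ring.
have tl := le_trans tv vl.
rewrite /root dpp; have [ta _|ta] := eqVneq t a.
  have lT : l.
    have := mem_head y ys; rewrite bigE; have -> : y = a.
      by apply/le_anti; rewrite ay -ta (le_trans yu ut).
    by move=> /in_big[[]|[/eqP]|[]]; rewrite ?ltxx // lt_eqF.
  rewrite ta lT subrr expr1 mulr0 mul0r add0r mulr0 subr0 mul1r mulrA.
  by rewrite mulr_gt0 ?sgna // exprn_gt0 // subr_gt0.
have [tb' _|tb'] := eqVneq t b.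
  have rT : r.
    have := mem_last y ys; rewrite bigE; have -> : last y ys = b.
      by apply/le_anti; rewrite lb -{1}tb'.
    by move=> /in_big[[/eqP]|[]|[]]; rewrite ?ltxx ?andbF // gt_eqF.
  rewrite tb' rT subrr expr1 mulr0 add0r mulr0 sub0r mul1r mulrN.
  rewrite mulrN mulrA -mulNr mulr_gt0 ?oppr_gt0 ?sgnb //.
  by rewrite exprn_gt0 // subr_gt0.
have {at_ ta} at_ : a < t by rewrite lt_def ta.
have {tb tb'} tb : t < b by rewrite lt_def eq_sym tb'.
rewrite /pp !hornerM !horner_exp hornerXsubC hornerD hornerN hornerC hornerX.
rewrite !mulf_eq0 !expf_eq0 !subr_eq0 (gt_eqF at_) (gt_eqF tb) !andbF !orbF.
move=> /eqP pt0; rewrite pt0 mul0r addr0 -!mulrA !mulrA -mulrA.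
rewrite mulr_gt0 ?sgn ?at_ //; first by apply/rootP.
by rewrite mulr_gt0 // exprn_gt0 // subr_gt0.
Qed.

(** * Zeros of Jacobi polynomials *)

Lemma jacobi_eval1 (R : realType) (a b : R) (n : nat) :
  n.+1%:R * (jacobi a b n.+1).[1] = (a + 1) * (jacobi (a + 1) (b + 1) n).[1].
Proof.
have /(congr1 (horner^~ 1)) := jacobi_rodrigues a b n.
rewrite !(hornerZ, hornerD, hornerN, hornerM, hornerX, hornerXn, hornerC).
by move=> E; apply: (@mulfI _ (- 2)); [lra|]; rewrite mulrA -[_ * n.+1%:R]mulrC; lra.
Qed.

Lemma jacobi_evalN1 (R : realType) (a b : R) (n : nat) :
  n.+1%:R * (jacobi a b n.+1).[-1] =
  - (b + 1) * (jacobi (a + 1) (b + 1) n).[-1].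
Proof.
have /(congr1 (horner^~ (-1))) := jacobi_rodrigues a b n.
rewrite !(hornerZ, hornerD, hornerN, hornerM, hornerX, hornerXn, hornerC).
move=> E; lra.
Qed.

Lemma jacobi_neq0_at1 (R : realType) (a b : R) (n : nat) :
  -1 < a -> (jacobi a b n).[1] != 0.
Proof.
elim: n a b => [|n IH] a b a1; first by rewrite jacobi0 hornerC oner_neq0.
have : (jacobi (a + 1) (b + 1) n).[1] != 0 by apply: IH; lra.
apply: contra => /eqP J0; have := jacobi_eval1 a b n.
by rewrite J0 mulr0 => /esym/eqP; rewrite mulf_eq0 gt_eqF //; lra.
Qed.

(** Up to sign the value at [-1] is [(b + 1) ... (b + n) / n!], and the hypothesis excludes a
    vanishing factor. This form also allows [b < -1], which occurs for [b = beta - 1]. *)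
Lemma jacobi_neq0_atN1 (R : realType) (a b : R) (n : nat) :
  (forall k, (k < n)%N -> b + 1 + k%:R != 0) -> (jacobi a b n).[-1] != 0.
Proof.
elim: n a b => [|n IH] a b bk; first by rewrite jacobi0 hornerC oner_neq0.
have : (jacobi (a + 1) (b + 1) n).[-1] != 0.
  by apply: IH => k kn; have := bk k.+1 kn; rewrite -natr1 addrA addrAC.
apply: contra => /eqP J0; have := jacobi_evalN1 a b n.
have := bk 0%N isT; rewrite addr0 => b1.
by rewrite J0 mulr0 => /esym/eqP; rewrite mulf_eq0 oppr_eq0 (negPf b1).
Qed.

(* A common zero of [P_(n+1)] and its derivative is, by the derivative formula and
   the Rodrigues relation, a common zero of [P_n] (with shifted parameters) and
   its derivative; descend to [P_0 = 1]. *)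
Lemma jacobi_simple_zeros (R : realType) (a b x : R) (n : nat) :
  (forall k, (k < n)%N -> n%:R + a + b + 1 + k%:R != 0) ->
  -1 < x < 1 -> root (jacobi a b n) x -> (jacobi a b n)^`().[x] != 0.
Proof.
move=> abk x1; elim: n a b abk => [|n IH] a b abk.
  by rewrite jacobi0 (negPf (root1 x)).
move=> /rootP J0; rewrite deriv_jacobi hornerZ mulf_neq0 //.
  rewrite mulf_neq0 ?invr_neq0 // ?pnatr_eq0 //.
  by have := abk 0%N isT; rewrite addr0.
apply/negP => Q0.
have /negP : (jacobi (a + 1) (b + 1) n)^`().[x] != 0.
  apply: IH Q0 => k kn; apply: contraNneq (abk k.+1 kn) => E.
  by apply/eqP; rewrite -E -!natr1; ring.
apply; have /(congr1 (horner^~ x)) := jacobi_rodrigues a b n.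
rewrite !(hornerZ, hornerD, hornerN, hornerM, hornerX, hornerXn, hornerC).
rewrite J0 (eqP Q0) !mulr0 addr0 => /esym/eqP; rewrite mulf_eq0 => /orP[|//].
case/andP: x1 => x1 x2; rewrite gt_eqF // subr_gt0; nra.
Qed.

Lemma size_jacobi_le (R : realType) (a b : R) (n : nat) :
  (size (jacobi a b n) <= n.+1)%N.
Proof.
elim: n a b => [|n IH] a b; first by rewrite jacobi0 size_poly1.
apply/leq_sizeP => k nk.
have k0 : k.-1.+1 = k by case: (k) nk.
have /(congr1 (fun p : {poly R} => p`_k.-1)) := deriv_jacobi a b n.
rewrite coef_deriv coefZ k0 [X in _ * X]nth_default ?mulr0; last first.
  by apply: leq_trans (IH _ _) _; rewrite -ltnS k0.
by move/eqP; rewrite mulrn_eq0 -k0 => /orP[//|/eqP].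
Qed.

(** The hypothesis lists the factors of the leading coefficient, which the derivative formula
    releases one at a time. *)
Lemma size_jacobi (R : realType) (a b : R) (n : nat) :
  (forall k, (k < n)%N -> n%:R + a + b + 1 + k%:R != 0) ->
  size (jacobi a b n) = n.+1.
Proof.
move=> abk; apply/eqP; rewrite eqn_leq size_jacobi_le /=.
suff : (jacobi a b n)`_n != 0 by apply: contraNltn => /leq_sizeP ->.
elim: n a b abk => [|n IH] a b abk; first by rewrite jacobi0 coef1 oner_neq0.
have : (jacobi (a + 1) (b + 1) n)`_n != 0.
  apply: IH => k kn; apply: contraNneq (abk k.+1 kn) => E.
  by apply/eqP; rewrite -E -!natr1; ring.
apply: contraNneq => J0.
have /(congr1 (fun p : {poly R} => p`_n)) := deriv_jacobi a b n.
rewrite coef_deriv coefZ J0 mul0rn => /esym/eqP; rewrite !mulf_eq0 invr_eq0.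
by have := abk 0%N isT; rewrite addr0 pnatr_eq0 orbF => /negPf ->.
Qed.

(** Interlacing from [P_n^(a+1, b+1)] to [P_(n+1)^(a, b)]: since [a > -1] the endpoint [1] always
    provides a further gap, while [-1] provides one only when [b > -1]. *)
Lemma jacobi_zeros_step (R : realType) (a b : R) (n : nat) :
  -1 < a ->
  (forall k, (k < n.+1)%N -> n.+1%:R + a + b + 1 + k%:R != 0) ->
  (forall k, (k < n)%N -> b + 2 + k%:R != 0) ->
  has_zeros (-1) 1 (jacobi (a + 1) (b + 1) n) n ->
  has_zeros (-1) 1 (jacobi a b n.+1) (n + (-1 < b)%R).
Proof.
move=> a1 abk bk zQ.
have Qb : (jacobi (a + 1) (b + 1) n).[-1] != 0.
  apply: jacobi_neq0_atN1 => k kn; have := bk k kn.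
  by apply: contraNneq => E; apply/eqP; rewrite -E; ring.
have Qa : (jacobi (a + 1) (b + 1) n).[1] != 0 by apply: jacobi_neq0_at1; lra.
have n0 : 0 < n.+1%:R :> R by rewrite ltr0n.
suff: has_zeros (-1) 1 (jacobi a b n.+1) (n + (-1 < b)%R + true).-1.
  by rewrite addn1.
apply: (@has_zeros_interlace _ _ _ (-1)) zQ; first by lra.
- move=> x x1 Qx.
  have dQx : (jacobi (a + 1) (b + 1) n)^`().[x] != 0.
    apply: jacobi_simple_zeros => // k kn; apply: contraNneq (abk k.+1 kn) => E.
    by apply/eqP; rewrite -E -!natr1; ring.
  have /(congr1 (horner^~ x)) := jacobi_rodrigues a b n.
  rewrite !(hornerZ, hornerD, hornerN, hornerM, hornerX, hornerXn, hornerC).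
  rewrite (rootP Qx) mulr0 addr0 => E.
  rewrite -(pmulr_rgt0 _ (_ : 0 < 2 * n.+1%:R)); last by rewrite mulr_gt0.
  rewrite !mulrA mulrN1 E -mulrA pmulr_lgt0.
    by case/andP: x1 => x1 x2; rewrite subr_gt0; nra.
  by rewrite -expr2 exprn_even_gt0.
- move=> b1; rewrite -(pmulr_rgt0 _ n0) !mulrA mulrN1 mulNr.
  rewrite jacobi_evalN1 -mulNr opprK -mulrA mulr_gt0 //; first by lra.
  by rewrite -expr2 exprn_even_gt0.
- move=> _; rewrite -(pmulr_rlt0 _ n0) !mulrA mulrN1 mulNr.
  rewrite jacobi_eval1 mulNr oppr_lt0 -mulrA mulr_gt0 //; first by lra.
  by rewrite -expr2 exprn_even_gt0.
Qed.

Lemma jacobi_zeros (R : realType) (a b : R) (n : nat) :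
  -1 < a -> -1 < b -> has_zeros (-1) 1 (jacobi a b n) n.
Proof.
elim: n a b => [|n IH] a b a1 b1; first exact: has_zeros0.
have := @jacobi_zeros_step R a b n a1; rewrite b1 addn1; apply.
- by move=> k kn; rewrite gt_eqF // -natr1; have := ler0n R k; have := ler0n R n; lra.
- by move=> k kn; rewrite gt_eqF //; have := ler0n R k; lra.
- by apply: IH; lra.
Qed.

(** * The Darboux transform *)

Lemma gbinom_gt0 (R : realType) (x : R) (k : nat) :
  (forall i, (i < k)%N -> 0 < x - i%:R) -> 0 < gbinom x k.
Proof.
elim: k => [|k IH] xk; first by rewrite gbinom0.
rewrite -(pmulr_rgt0 _ (ltr0Sn R k)) gbinomS mulr_gt0 ?xk // IH // => i ik.
by apply: xk; apply: ltnW.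
Qed.

Lemma gbinom_sign (R : realType) (x : R) (k : nat) :
  x < 0 -> 0 < (-1) ^+ k * gbinom x k.
Proof.
move=> x0; elim: k => [|k IH]; first by rewrite gbinom0 expr0 mulr1.
rewrite -(pmulr_rgt0 _ (ltr0Sn R k)) mulrCA gbinomS exprS.
have -> : -1 * (-1) ^+ k * ((x - k%:R) * gbinom x k) =
          (k%:R - x) * ((-1) ^+ k * gbinom x k) by ring.
by rewrite mulr_gt0 // subr_gt0 (lt_le_trans x0).
Qed.

(** In the nonnegative quantities [X = (1 - x) / 2] and [Y = (1 + x) / 2] no two terms have opposite
    signs. As [X + Y = 1], the term [s = 0] or the term [s = n] is nonzero. *)
Lemma jacobi_sign (R : realType) (a b t x : R) (n : nat) :
  (forall s, (s <= n)%N -> 0 < t * (-1) ^+ s * jacobi_coef a b n s) ->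
  -1 <= x <= 1 -> 0 < t * (jacobi a b n).[x].
Proof.
move=> ts /andP[x1 x2].
pose X := (1 - x) / 2; pose Y := (1 + x) / 2.
have X0 : 0 <= X by rewrite divr_ge0 //; lra.
have Y0 : 0 <= Y by rewrite divr_ge0 //; lra.
have -> : t * (jacobi a b n).[x] =
  \sum_(s < n.+1) (t * (-1) ^+ s * jacobi_coef a b n s) * (X ^+ s * Y ^+ (n - s)).
  rewrite jacobiE horner_sum mulr_sumr; apply: eq_bigr => s _.
  rewrite hornerZ /jacobi_mono hornerM !horner_exp !hornerZ !hornerD hornerN hornerX.
  rewrite !hornerC.
  have -> : 2^-1 * (x - 1) = - X by rewrite /X; field.
  have -> : 2^-1 * (x + 1) = Y by rewrite /Y; field.
  by rewrite (exprNn X); move: ((-1) ^+ s) (X ^+ s) (Y ^+ _) => c d e; ring.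
have F0 (s : 'I_n.+1) : true ->
    0 <= (t * (-1) ^+ s * jacobi_coef a b n s) * (X ^+ s * Y ^+ (n - s)).
  move=> _; apply: mulr_ge0; first by apply/ltW/ts; rewrite -ltnS.
  by rewrite mulr_ge0 ?exprn_ge0.
rewrite lt_def sumr_ge0 // andbT psumr_eq0 //; apply/allPn => /=.
have [Y00|Y00] := eqVneq Y 0.
  exists ord_max; first by rewrite mem_index_enum.
  apply: mulf_neq0; first by rewrite gt_eqF // ts.
  rewrite subnn expr0 mulr1 expf_neq0 //.
  by apply: contra_eqN Y00 => /eqP; rewrite /X /Y => E; apply/eqP; lra.
exists ord0; first by rewrite mem_index_enum.
apply: mulf_neq0; first by rewrite gt_eqF // ts.
by rewrite expr0 mul1r expf_neq0.
Qed.

(** Since [y'] is a multiple of [P_(n-1)^(a+1, b+1)], the left side is the same multiple of the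
    Rodrigues relation. *)
Lemma jacobi_ode (R : realType) (a b : R) (n : nat) :
  let y := jacobi a b n in
  (1 - 'X^2) * y^`()^`() + ((b + 1) *: (1 - 'X) - (a + 1) *: (1 + 'X)) * y^`() =
  (- (n%:R * (n%:R + a + b + 1))) *: y.
Proof.
case: n => [|n] y; rewrite {}/y.
  by rewrite jacobi0 derivC deriv0 !mulr0 add0r mul0r oppr0 scale0r.
rewrite deriv_jacobi derivZ -!scalerAr -scalerDr -jacobi_rodrigues scalerA.
by congr (_ *: _); field.
Qed.

(* Up to sign, [u^2 (1 - z)^(1 - c) d/dz ((1 - z)^c y / u)]. *)
Definition darboux (R : realType) (c : R) (u y : {poly R}) : {poly R} :=
  ('X - 1) * (u * y^`() - u^`() * y) + c *: (u * y).

(** The first summand contains [y'] by the derivative formula. In the second, [jacobi_lower] gives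
    [(alpha + 1 - m) P_m^(-alpha-2, beta) = (alpha + 1) u - (z - 1) u']. *)
Lemma xjacobiE (R : realType) (alpha beta : R) (m j : nat) :
  xjacobi alpha beta m j =
  ((-1) ^+ m / (alpha + 1 + j%:R)) *:
    darboux (alpha + 1) (jacobi (- alpha - 1) (beta - 1) m)
                        (jacobi (alpha + 1) (beta - 1) j).
Proof.
rewrite /xjacobi; congr (_ *: _); rewrite /darboux.
have -> : (2^-1 * (1 + alpha + beta + j%:R)) *: (('X - 1) *
    jacobi (- alpha - 1) (beta - 1) m * jacobi (alpha + 2) beta (j%:Z - 1)) =
  ('X - 1) * jacobi (- alpha - 1) (beta - 1) m *
    (jacobi (alpha + 1) (beta - 1) j)^`().
  (* For [j = 0] the convention [P_(-1) = 0] matches the derivative of the constant [y = 1]. *)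
  rewrite scalerAr; congr (_ * _); case: j => [|j].
    by rewrite jacobi0 derivC /= scaler0.
  have -> : (j.+1%:Z - 1 = j)%R by rewrite -addn1 PoszD addrK.
  by rewrite deriv_jacobi subrK; congr (_ *: jacobi _ _ _); [field|ring].
have := jacobi_lower (- alpha - 1) (beta - 1) m.
have -> : - alpha - 1 - 1 = - alpha - 2 by ring.
rewrite subrK => /(congr1 (fun p => - p)); rewrite -scaleNr.
have -> : - (m%:R + (- alpha - 1)) = alpha + 1 - m%:R by ring.
rewrite scalerAl => <-; rewrite -!mul_polyC.
have -> : (- alpha - 1)%:P = - (alpha + 1)%:P by rewrite -polyCN opprD.
move: (jacobi _ _ _) (jacobi _ _ _) => u y; ring.
Qed.

(** Second derivatives enter through [(1 - z^2) (u'' y - u y'')]. They cancel against [y] times the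
    equation of [u] minus [u] times the equation of [y]. *)
Lemma darboux_adjoint (R : realType) (alpha beta : R) (m j : nat) :
  let u := jacobi (- alpha - 1) (beta - 1) m in
  let y := jacobi (alpha + 1) (beta - 1) j in
  let W := darboux (alpha + 1) u y in
  (1 + 'X) * W^`() + beta *: W =
  ((m%:R + j%:R + beta) * (j%:R + alpha + 1 - m%:R)) *: (u * y).
Proof.
move=> u y W; have := jacobi_ode (- alpha - 1) (beta - 1) m.
have := jacobi_ode (alpha + 1) (beta - 1) j; rewrite /= -/u -/y.
rewrite !subrK /W /darboux !(derivB, derivD, derivM, derivZ, derivX, derivC) subr0.
clear W; clearbody u y.
rewrite -!mul_polyC !(polyCM, polyCD, polyCN, polyC_natr, polyC1).
move: (u^`()^`()) (y^`()^`()) (u^`()) (y^`()) alpha%:P beta%:P => u2 y2 u1 y1 a b.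
move=> /eqP; rewrite -subr_eq0 => /eqP Ey /eqP; rewrite -subr_eq0 => /eqP Eu.
apply/eqP; rewrite -subr_eq0; apply/eqP.
transitivity (y * 0 - u * 0 : {poly R}); last by rewrite !mulr0 subr0.
by rewrite -{1}Eu -Ey; ring.
Qed.

(** The upper entry [m - alpha - 1] of the first binomial is negative in case (B) and lies in
    [(0, 1)] in case (A). Its signs thus alternate, in case (A) from the lower index [1] on, which
    fixes [t]. *)
Lemma jacobi_constant_sign (R : realType) (m : nat) (alpha beta : R) :
  (1 <= m)%N ->
  (-1 < beta < 0 /\ -1 < alpha + 1 - m%:R < 0) \/
    (0 < beta /\ 0 < alpha + 1 - m%:R) ->
  exists t : R, forall x, -1 <= x <= 1 ->
    0 < t * (jacobi (- alpha - 1) (beta - 1) m).[x].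
Proof.
move=> m1 hAB.
have sgnM s k : (s <= m)%N -> (m - s = k)%N ->
    (-1) ^+ m * (-1) ^+ s = (-1) ^+ k :> R.
  move=> sm <-; rewrite -{1}(subnK sm) exprD -mulrA -exprD addnn.
  by rewrite -[X in _ * X]signr_odd odd_double mulr1.
case: hAB => [[/andP[b1 b2] /andP[a1 a2]]|[b0 a0]].
  exists (- (-1) ^+ m) => x; apply: jacobi_sign => s sm; rewrite /jacobi_coef.
  have gt_s i : (i.+1 < m)%N -> 0 < m%:R + (beta - 1) - i%:R.
    by rewrite -(ler_nat R) -!natr1 => im; lra.
  have [sm'|sm'] := ltnP s m.
    have [k mk] : exists k, (m - s = k.+1)%N.
      by exists (m - s).-1; rewrite prednK // subn_gt0.
    rewrite mk mulNr (sgnM s k.+1) // mulrA mulr_gt0 //; last first.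
      by apply: gbinom_gt0 => i si; apply: gt_s; apply: leq_trans sm'.
    rewrite -(pmulr_rgt0 _ (ltr0Sn R k)) mulrCA.
    have -> : m%:R + (- alpha - 1) = (m%:R - alpha - 2) + 1 by ring.
    rewrite gbinomSS exprS mulN1r opprK mulrCA mulr_gt0 //; first lra.
    by apply: gbinom_sign; lra.
  (* Here the first binomial is [1], and the last factor [beta] makes the second one negative, which
     restores the common sign. *)
  have -> : s = m by apply/eqP; rewrite eqn_leq sm.
  rewrite mulNr (sgnM m 0%N) ?subnn // gbinom0 expr0 mul1r mulN1r oppr_gt0.
  case: (m) m1 gt_s => // k _ gt_s.
  rewrite -(pmulr_rlt0 _ (ltr0Sn R k)) gbinomS -natr1 nmulr_rlt0; last lra.
  by apply: gbinom_gt0 => i ik; have := gt_s i ik; rewrite -natr1; lra.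
exists ((-1) ^+ m) => x; apply: jacobi_sign => s sm; rewrite /jacobi_coef.
rewrite (sgnM s (m - s)%N) // mulrA mulr_gt0 //; first by apply: gbinom_sign; lra.
apply: gbinom_gt0 => i si; have : (i < m)%N by apply: leq_trans sm.
by rewrite -(ler_nat R) -natr1; lra.
Qed.

(** Rolle gives zeros of the derivative between those of [P_(n+1)]. As [b < -1], polynomial and
    derivative have the same sign at [-1], which adds one zero before the first. So [k] zeros force
    [k] zeros of a polynomial of degree at most [n]. *)
Lemma jacobi_zeros_max (R : realType) (a b : R) (n k : nat) :
  b < -1 -> (forall i, (i < n.+1)%N -> 0 < n.+1%:R + a + b + 1 + i%:R) ->
  (jacobi (a + 1) (b + 1) n).[-1] != 0 ->
  has_zeros (-1) 1 (jacobi a b n.+1) k -> (k <= n)%N.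
Proof.
move=> b1 abk Qb zP.
have c0 : 0 < n.+1%:R + a + b + 1 by have := abk 0%N isT; rewrite addr0.
have Q0 : jacobi (a + 1) (b + 1) n != 0.
  by apply: contraNneq Qb => ->; rewrite horner0.
suff: has_zeros (-1) 1 (jacobi (a + 1) (b + 1) n) (k + true + false).-1.
  rewrite addn0 addn1 => /(has_zeros_size Q0) kn.
  by rewrite -ltnS (leq_trans kn) // size_jacobi_le.
apply: (@has_zeros_interlace _ _ _ 1) zP => //; first by lra.
- move=> x x1 Px.
  have : (jacobi a b n.+1)^`().[x] != 0.
    by apply: jacobi_simple_zeros => // i i1; rewrite gt_eqF // abk.
  rewrite deriv_jacobi hornerZ mulf_eq0 negb_or => /andP[_ Qx].
  by rewrite mul1r mulrCA mulr_gt0 ?divr_gt0 // -expr2 exprn_even_gt0.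
- move=> _; rewrite mul1r -(pmulr_rgt0 _ (ltr0Sn R n)) mulrCA jacobi_evalN1.
  rewrite mulrCA mulr_gt0 //; first lra.
  by rewrite -expr2 exprn_even_gt0.
Qed.

Lemma darboux_root (R : realType) (c x : R) (u y : {poly R}) :
  root y x -> (darboux c u y).[x] = (x - 1) * (u.[x] * y^`().[x]).
Proof.
move=> /rootP y0; rewrite /darboux !(hornerXsubC, hornerD, hornerN, hornerM, hornerZ).
by rewrite y0; ring.
Qed.

Lemma size_darboux_le (R : realType) (c : R) (u y : {poly R}) (m j : nat) :
  (size u <= m.+1)%N -> (size y <= j.+1)%N ->
  (size (darboux c u y) <= (m + j).+1)%N.
Proof.
move=> su sy.
have sder (p : {poly R}) k : (size p <= k.+1)%N -> (size p^`() <= k)%N.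
  move=> sp; apply/leq_sizeP => i ki.
  by rewrite coef_deriv nth_default ?mul0rn // (leq_trans sp).
have sM (p q : {poly R}) a b : (size p <= a.+1)%N -> (size q <= b)%N ->
    (size (p * q : {poly R})%R <= a + b)%N.
  move=> sp sq; rewrite (leq_trans (size_polyMleq _ _)) //.
  by rewrite -subn1 leq_subLR addnA add1n leq_add.
rewrite /darboux (leq_trans (size_polyD _ _)) // geq_max; apply/andP; split.
  rewrite -add1n sM ?(size_XsubC 1) // (leq_trans (size_polyD _ _)) // geq_max.
  by rewrite size_polyN sM ?sder //= mulrC addnC sM ?sder.
by rewrite (leq_trans (size_scale_leq _ _)) // -addnS sM.
Qed.

(** The operator of the adjoint relation does not raise the degree; as it sends [W] to a nonzero
    multiple of [u y], this bounds the degree of [W] from below. *)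
Lemma size_adjoint_le (R : idomainType) (b : R) (W : {poly R}) :
  (size ((1 + 'X) * W^`() + b *: W)%R <= size W)%N.
Proof.
have [->|W0] := eqVneq W 0; first by rewrite deriv0 mulr0 scaler0 addr0 size_poly0.
rewrite (leq_trans (size_polyD _ _)) // geq_max size_scale_leq andbT.
rewrite (leq_trans (size_polyMleq _ _)) // addrC (size_XaddC 1).
exact: lt_size_deriv.
Qed.

Lemma mulr_sqr_gt0 (R : realDomainType) (c v : R) :
  0 < c -> v != 0 -> 0 < c * v ^+ 2.
Proof. by move=> c0 v0; rewrite mulr_gt0 // exprn_even_gt0. Qed.

(** * Number of zeros of the Darboux transform in (-1, 1) *)

Section DarbouxZeros.

Variables (R : realType) (m j : nat) (alpha beta : R).

Hypothesis hm : (1 <= m)%N.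
Hypothesis hdeg : forall k : nat, (k < m)%N -> alpha + 1 - m%:R - beta <> k%:R.
Hypothesis hAB : (-1 < beta < 0 /\ -1 < alpha + 1 - m%:R < 0) \/
                 (0 < beta /\ 0 < alpha + 1 - m%:R).

Let u := jacobi (- alpha - 1) (beta - 1) m.
Let y := jacobi (alpha + 1) (beta - 1) j.
Let W := darboux (alpha + 1) u y.
Let C := (m%:R + j%:R + beta) * (j%:R + alpha + 1 - m%:R).

Let alpha_gt : -1 < alpha.
Proof.
have : (1 : R) <= m%:R by rewrite ler1n.
by case: hAB => [[_ /andP[]]|[]]; lra.
Qed.

Let beta_gt : -1 < beta.
Proof. by case: hAB => [[/andP[]]|[]]; lra. Qed.

Let beta_neq0 : beta != 0.
Proof. by case: hAB => [[/andP[_ /lt_eqF->]]|[/gt_eqF->]]. Qed.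

(** The factor [m + j + beta] is always positive; [j + alpha + 1 - m] is negative only in case (A)
    with [j = 0]. *)
Let C_gt0 : (0 < beta) || (0 < j)%N -> 0 < C.
Proof.
have m1 : (1 : R) <= m%:R by rewrite ler1n.
have j0 := ler0n R j.
case: hAB => [[/andP[b1 b2] /andP[a1 a2]]|[b0 a0]] bj.
  have : (1 : R) <= j%:R by move: bj; rewrite ltNge (ltW b2) ler1n.
  by move=> j1; rewrite mulr_gt0 //; lra.
by rewrite mulr_gt0 //; lra.
Qed.

Let C_lt0 : j = 0%N -> beta < 0 -> C < 0.
Proof.
move=> j0 b0; rewrite /C j0; have m1 : (1 : R) <= m%:R by rewrite ler1n.
by case: hAB => [[b1 /andP[a1 a2]]|[]]; [rewrite pmulr_rlt0; lra|lra].
Qed.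

Let C_neq0 : C != 0.
Proof.
have [bj|] := boolP ((0 < beta) || (0 < j)%N); first by rewrite gt_eqF // C_gt0.
rewrite negb_or -leNgt -eqn0Ngt => /andP[b0 /eqP j0].
by rewrite lt_eqF // C_lt0 // lt_def eq_sym beta_neq0.
Qed.

Let y_index_gt0 k : (k < j)%N -> 0 < j%:R + (alpha + 1) + (beta - 1) + 1 + k%:R.
Proof.
move=> kj; have : (1 : R) <= j%:R by rewrite ler1n (leq_ltn_trans _ kj).
have := ler0n R k; have := alpha_gt; have := beta_gt; lra.
Qed.

Let y1_neq0 : y.[1] != 0.
Proof. by apply: jacobi_neq0_at1; have := alpha_gt; lra. Qed.

Let yN1_neq0 : y.[-1] != 0.
Proof.
(* The factor for [k = 0] is [beta], nonzero but possibly negative; the later ones are positive. *)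
apply: jacobi_neq0_atN1 => -[|k] _; first by rewrite addr0 subrK.
by rewrite gt_eqF // -natr1; have := ler0n R k; have := beta_gt; lra.
Qed.

Let y_simple x : -1 < x < 1 -> root y x -> y^`().[x] != 0.
Proof.
by move=> x1; apply: jacobi_simple_zeros => // k /y_index_gt0 /gt_eqF->.
Qed.

Let size_y : size y = j.+1.
Proof. by apply: size_jacobi => k /y_index_gt0 /gt_eqF->. Qed.

(** The factors of the leading coefficient of [u] are [k - (alpha + 1 - m - beta)] with [k < m], so
    [hdeg] is the condition for full degree. *)
Let size_u : size u = m.+1.
Proof.
apply: size_jacobi => k km; apply/eqP => E; apply: (hdeg km); lra.
Qed.

Let adjoint x : (1 + x) * W^`().[x] + beta * W.[x] = C * (u.[x] * y.[x]).
Proof.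
have /(congr1 (horner^~ x)) := darboux_adjoint alpha beta m j.
by rewrite /= !(hornerZ, hornerD, hornerM) hornerX hornerC.
Qed.

Let W1 : W.[1] = (alpha + 1) * (u.[1] * y.[1]).
Proof.
rewrite /W /darboux hornerD hornerM (hornerXsubC 1) subrr mul0r add0r.
by rewrite hornerZ hornerM.
Qed.

Let WN1 : beta * W.[-1] = C * (u.[-1] * y.[-1]).
Proof. by rewrite -adjoint subrr mul0r add0r. Qed.

Let u_sign : exists t, forall x, -1 <= x <= 1 -> 0 < t * u.[x].
Proof. exact: jacobi_constant_sign. Qed.

Let u_neq0 x : -1 <= x <= 1 -> u.[x] != 0.
Proof.
by have [t ts] := u_sign => /ts; apply: contraTneq => ->; rewrite mulr0 ltxx.
Qed.

Let in1 : -1 <= (1 : R) <= 1. Proof. lra. Qed.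
Let inN1 : -1 <= (-1 : R) <= 1. Proof. lra. Qed.
Let inx (x : R) : -1 < x < 1 -> -1 <= x <= 1.
Proof. by case/andP => /ltW -> /ltW ->. Qed.

Lemma darboux_neq0_at1 : W.[1] != 0.
Proof. by rewrite W1 !mulf_neq0 ?u_neq0 // gt_eqF //; have := alpha_gt; lra. Qed.

Lemma darboux_neq0_atN1 : W.[-1] != 0.
Proof.
have : beta * W.[-1] != 0 by rewrite WN1 mulf_neq0 ?C_neq0 // mulf_neq0 ?yN1_neq0 ?u_neq0.
by rewrite mulf_eq0 negb_or => /andP[].
Qed.

Let y_neq0_root x : -1 < x < 1 -> root W x -> y.[x] != 0.
Proof.
move=> x1 /rootP Wx; apply/negP => yx; have /negP := y_simple x1 yx; apply.
have := Wx; rewrite /W darboux_root // => /eqP; rewrite !mulf_eq0.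
rewrite (negPf (u_neq0 (inx x1))) subr_eq0 lt_eqF //.
by case/andP: x1.
Qed.

Lemma darboux_simple x : -1 < x < 1 -> root W x -> W^`().[x] != 0.
Proof.
move=> x1 Wx; have := adjoint x; rewrite (rootP Wx) mulr0 addr0 => E.
apply/eqP => dW; move/eqP: E; rewrite dW mulr0 eq_sym; apply/negP.
by rewrite mulf_neq0 ?C_neq0 // mulf_neq0 ?y_neq0_root // u_neq0 ?inx.
Qed.

Lemma size_darboux : size W = (m + j).+1.
Proof.
apply/eqP; rewrite eqn_leq size_darboux_le ?size_u ?size_y //=.
have := size_adjoint_le beta W; rewrite darboux_adjoint -/u -/y -/C.
have u0 : u != 0 by rewrite -size_poly_gt0 size_u.
have y0 : y != 0 by rewrite -size_poly_gt0 size_y.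
by rewrite size_scale // size_mul // size_u size_y addSn addnS.
Qed.

Lemma darboux_has_zeros : has_zeros (-1) 1 W j.
Proof.
have [j0|j0] := posnP j; first by rewrite j0; apply: has_zeros0.
have [t ut] := u_sign; have a1 := alpha_gt; have b1 := beta_gt.
have zy : has_zeros (-1) 1 y (j.-1 + (0 < beta)%R).
  have := @jacobi_zeros_step R (alpha + 1) (beta - 1) j.-1.
  rewrite prednK // (_ : (-1 < beta - 1) = (0 < beta)); last first.
    by rewrite ltrBrDr addNr.
  apply; first lra.
  - by move=> k /y_index_gt0 /gt_eqF->.
  - by move=> k _; rewrite gt_eqF //; have := ler0n R k; lra.
  - by apply: jacobi_zeros; lra.
(* Exactly one of [0 < beta] and [beta < 0] holds: the zero that [y] lacks for negative [beta] is
   made up by the gap at [-1]. *)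
have -> : j = (j.-1 + (0 < beta)%R + (beta < 0)%R + true).-1.
  have b01 : ((0 < beta)%R + (beta < 0)%R = 1)%N by case: ltgtP beta_neq0.
  by rewrite -(addnA j.-1) b01 !addn1 prednK.
apply: (@has_zeros_interlace _ _ _ (- t)) zy; first by lra.
- move=> x x1 yx; rewrite darboux_root //.
  have -> : - t * ((x - 1) * (u.[x] * y^`().[x])) * y^`().[x] =
    (1 - x) * (t * u.[x] * y^`().[x] ^+ 2) by ring.
  case/andP: (x1) => x0 x2; apply: mulr_gt0; first by rewrite subr_gt0.
  by apply: mulr_sqr_gt0; [apply: ut; apply: inx|apply: y_simple].
- move=> b0; rewrite -(nmulr_rlt0 _ b0).
  have -> : beta * (- t * W.[-1] * y.[-1]) = - t * (beta * W.[-1]) * y.[-1] by ring.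
  rewrite WN1.
  have -> : - t * (C * (u.[-1] * y.[-1])) * y.[-1] =
    - (C * (t * u.[-1] * y.[-1] ^+ 2)) by ring.
  rewrite oppr_lt0; apply: mulr_gt0; first by rewrite C_gt0 // j0 orbT.
  by apply: mulr_sqr_gt0 => //; apply: ut.
- move=> _; rewrite W1.
  have -> : - t * ((alpha + 1) * (u.[1] * y.[1])) * y.[1] =
    - ((alpha + 1) * (t * u.[1] * y.[1] ^+ 2)) by ring.
  rewrite oppr_lt0; apply: mulr_gt0; first lra.
  by apply: mulr_sqr_gt0 => //; apply: ut.
Qed.

(** Interlacing from [W] back to [y]. The endpoint [-1] counts when [beta > 0], and [1] counts when
    [C < 0]. If one of them counts, [y] has [k] zeros and its degree bounds [k]. *)
Lemma darboux_zeros_max k : has_zeros (-1) 1 W k -> (k <= j)%N.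
Proof.
move=> zW; have [t ut] := u_sign; have a1 := alpha_gt; have b1 := beta_gt.
have zy : has_zeros (-1) 1 y (k + (0 < beta)%R + (C < 0)%R).-1.
  apply: (@has_zeros_interlace _ _ _ (t * C)) zW; first by lra.
  - move=> x x1 Wx; case/andP: (x1) => x0 _.
    have x3 : 0 < 1 + x by lra.
    rewrite -(pmulr_rgt0 _ x3) mulrCA.
    have := adjoint x; rewrite (rootP Wx) mulr0 addr0 => ->.
    have -> : t * C * y.[x] * (C * (u.[x] * y.[x])) =
      t * u.[x] * (C * y.[x]) ^+ 2 by ring.
    apply: mulr_sqr_gt0; first by apply: ut; apply: inx.
    by rewrite mulf_neq0 ?C_neq0 // y_neq0_root.
  - move=> b0; rewrite -(pmulr_rgt0 _ b0) mulrCA WN1.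
    have -> : t * C * y.[-1] * (C * (u.[-1] * y.[-1])) =
      t * u.[-1] * (C * y.[-1]) ^+ 2 by ring.
    by apply: mulr_sqr_gt0; [apply: ut|rewrite mulf_neq0 ?C_neq0].
  - move=> C0; rewrite W1.
    have -> : t * C * y.[1] * ((alpha + 1) * (u.[1] * y.[1])) =
      C * ((alpha + 1) * (t * u.[1] * y.[1] ^+ 2)) by ring.
    rewrite nmulr_rlt0 //.
    apply: mulr_gt0; first lra.
    by apply: mulr_sqr_gt0 => //; apply: ut.
have y0 : y != 0 by rewrite -size_poly_gt0 size_y.
have [b0|b0] := ltP 0 beta.
  move: zy; rewrite b0 ltNge ltW ?C_gt0 ?b0 // addn0 addn1 => /(has_zeros_size y0).
  by rewrite size_y ltnS.
have {}b0 : beta < 0 by rewrite lt_def eq_sym beta_neq0.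
have bN : (0 < beta) = false by apply/negbTE; rewrite -leNgt ltW.
have [j0|j0] := posnP j.
  move: zy; rewrite bN C_lt0 // addn0 addn1 => /(has_zeros_size y0).
  by rewrite size_y ltnS.
move: zy; rewrite bN [C < 0]ltNge ltW ?C_gt0 ?j0 ?orbT // !addn0 => zy.
(* No endpoint counts here, so only [k - 1] zeros of [y] are obtained. The sharper bound [j - 1] for
   [beta < 0] compensates for the loss. *)
suff kj : (k.-1 <= j.-1)%N.
  by rewrite (leq_trans (leqSpred k)) // -[X in (_ <= X)%N](prednK j0).
apply: (@jacobi_zeros_max R (alpha + 1) (beta - 1)); rewrite ?prednK //; first lra.
by apply: jacobi_neq0_atN1 => i _; rewrite gt_eqF //; have := ler0n R i; lra.
Qed.

End DarbouxZeros.

(** * Counting zeros with multiplicity *)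

Lemma sum_mup_root (F : closedFieldType) (q : {poly F}) : q != 0 ->
  (\sum_(z \in [set z : F | root q z]) mup z q)%N = (size q).-1.
Proof.
move=> q0; have [r qE] := closed_field_poly_normal q.
have lq0 : lead_coef q != 0 by rewrite lead_coef_eq0.
have mupE z : mup z q = count_mem z r.
  rewrite qE -mul_polyC mupMr ?mu_prod_XsubC //.
  by rewrite rootC.
have -> : [set z : F | root q z] = [set` undup r].
  apply/seteqP; split => z /=; rewrite {1}qE rootZ // root_prod_XsubC mem_undup //.
rewrite -fsbig_seq ?undup_uniq // {2}qE size_scale // size_prod_XsubC /=.
(* The length of [r] is a sum of ones, regrouped over the distinct entries with their counts. *)
rewrite -sum1_size -[RHS]big_undup_iterop_count.
apply: eq_bigr => z _; rewrite mupE.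
by case: (count_mem z r) => // n; rewrite iteropS iter_addn mul1n addn1.
Qed.

Lemma card_seq (T : choiceType) (xs : seq T) :
  uniq xs -> [set` xs] #= `I_(size xs).
Proof.
move=> uxs; have -> : [set` xs] = [set` [fset x in xs]%fset].
  by apply/seteqP; split => x /=; rewrite inE.
by apply/card_eq_fsetP; rewrite card_fseq undup_id.
Qed.

(** Divide [p] by the monic product [g] over its [j] regular zeros. These are simple and [p] is
    nonzero at the endpoints, so the exceptional zeros are exactly the complex zeros of the quotient
    [q], of degree [m]. *)
Lemma count_zeros (R : realType) (p : {poly R}) (m j : nat) :
  size p = (m + j).+1 -> p.[1] != 0 -> p.[-1] != 0 ->
  (forall x, -1 < x < 1 -> root p x -> p^`().[x] != 0) ->
  has_zeros (-1) 1 p j -> (forall k, has_zeros (-1) 1 p k -> (k <= j)%N) ->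
  regular_zeros p #= `I_j /\
  (\sum_(z \in exceptional_zeros p) mup z (complex_poly p))%N = m.
Proof.
move=> sp p1 pN1 simple [xs [uxs sxs] rxs] pmax.
have regE : regular_zeros p = [set` xs].
  apply/seteqP; split=> x /=; last by move=> /rxs.
  move=> rx; apply/negPn/negP => xs'.
  suff /pmax : has_zeros (-1) 1 p j.+1 by rewrite ltnn.
  exists (x :: xs); first by rewrite /= sxs xs' uxs.
  by move=> z; rewrite inE => /orP[/eqP->|/rxs].
split; first by rewrite regE -sxs; apply: card_seq.
have [q pE] : exists q, p = q * \prod_(z <- xs) ('X - z%:P).
  apply: uniq_roots_prod_XsubC; last by rewrite uniq_rootsE.
  by apply/allP => x /rxs[].
set g := \prod_(z <- xs) ('X - z%:P) in pE.
have p0 : p != 0 by rewrite -size_poly_gt0 sp.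
have q0 : q != 0 by apply: contraNneq p0 => q0; rewrite pE q0 mul0r.
have sq : size q = m.+1.
  apply/eqP; rewrite -(eqn_add2r j) addSn -sp pE size_Mmonic ?monic_prod_XsubC //.
  by rewrite size_prod_XsubC sxs addnS.
have cpE : complex_poly p = complex_poly q * complex_poly g.
  by rewrite pE /complex_poly rmorphM.
have root_g z : root (complex_poly g) z ->
    exists2 x, -1 < x < 1 & z = real_complex R x.
  rewrite /complex_poly map_prod_XsubC.
  rewrite -(big_map (real_complex R) predT (fun y => 'X - y%:P)).
  rewrite root_prod_XsubC => /mapP[x /rxs[x1 _] ->]; by exists x.
have excE : exceptional_zeros p = [set z | root (complex_poly q) z].
  apply/seteqP; split=> z.
    case; rewrite cpE rootM => /orP[//|/root_g[x /andP[x1 x2] ->]] /=.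
    case=> [|[_ []]]; first by rewrite eqxx.
      by rewrite ltNge (ltW x1).
    by rewrite ltNge (ltW x2).
  rewrite /exceptional_zeros /mkset => qz; split; first by rewrite cpE rootM qz.
  have [Im0|Im0] := eqVneq (complex.Im z) 0; last by left.
  right; split=> //; have zE : z = real_complex R (complex.Re z).
    by case: z Im0 {qz} => a b /= ->.
  move: qz; rewrite zE /complex_poly fmorph_root /=.
  set x := complex.Re z => qx.
  have px : root p x by rewrite pE rootM qx.
  have [x1|x1|x1] := ltgtP x (-1); first by left.
    have [x2|x2|x2] := ltgtP x 1; last 1 first.
    - by move: p1; rewrite -x2 (rootP px) eqxx.
    (* Both [q] and [g] would vanish at [x], hence also [p'], against simplicity. *)
    - have xxs : [set` xs] x by rewrite -regE; split; rewrite ?x1.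
      have := simple x; rewrite x1 x2 => /(_ isT px)/negP[].
      rewrite pE derivM hornerD !hornerM (rootP qx) mul0r addr0.
      by rewrite (_ : g.[x] = 0) ?mulr0 //; apply/rootP; rewrite root_prod_XsubC.
    - by right.
  by move: pN1; rewrite -x1 (rootP px) eqxx.
rewrite excE -[RHS]/(m.+1.-1) -sq -(size_map_poly (real_complex R) q).
rewrite -sum_mup_root ?map_poly_eq0 //.
apply: eq_fsbigr => z /set_mem; rewrite -excE => -[_ ez].
rewrite cpE mupMl //; apply/negP => /root_g[x /andP[x1 x2] zE].
case: ez; rewrite zE /= ?eqxx // => -[_ []]; rewrite ltNge.
  by rewrite (ltW x1).
by rewrite (ltW x2).
Qed.

Theorem proposition5p4 (R : realType) (m j : nat) (alpha beta : R)
  (hm : (1 <= m)%N)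
  (hdeg : forall k : nat, (k < m)%N -> alpha + 1 - m%:R - beta <> k%:R)
  (hAB : (-1 < beta < 0 /\ -1 < alpha + 1 - m%:R < 0) \/
         (0 < beta /\ 0 < alpha + 1 - m%:R)) :
  regular_zeros (xjacobi alpha beta m j) #= `I_j /\
  \sum_(z \in exceptional_zeros (xjacobi alpha beta m j))
     mup z (complex_poly (xjacobi alpha beta m j)) = m.
Proof.
(* In both cases [alpha + 1 > m - 1 >= 0], so the denominator is positive and its inverse is not the
   default [0]. *)
have c0 : (-1) ^+ m / (alpha + 1 + j%:R) != 0 :> R.
  have m1 : (1 : R) <= m%:R by rewrite ler1n.
  have j0 := ler0n R j.
  rewrite mulf_neq0 ?signr_eq0 // invr_eq0 gt_eqF //.
  by case: hAB => [[_ /andP[]]|[]]; lra.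
rewrite xjacobiE; set W := darboux _ _ _; set c := _ / _ in c0 *.
have has_zerosZ k : has_zeros (-1) 1 (c *: W) k <-> has_zeros (-1) 1 W k.
  by split=> -[xs uxs rxs]; exists xs => // x /rxs; rewrite rootZ.
apply: count_zeros.
- by rewrite size_scale // size_darboux.
- by rewrite hornerZ mulf_neq0 // darboux_neq0_at1.
- by rewrite hornerZ mulf_neq0 // darboux_neq0_atN1.
- by move=> x x1; rewrite rootZ // => Wx; rewrite derivZ hornerZ mulf_neq0 // darboux_simple.
- by apply/has_zerosZ/darboux_has_zeros.
- by move=> k /has_zerosZ/darboux_zeros_max; apply.
Qed.
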